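(* Let $G$ be a grid diagram. The tensor product over $\mathbb{Z}$ of the filtered chain complex $(\widetilde{C}^-(G),\widetilde{\partial}^-)$ with $\mathbb{Z}/2\mathbb{Z}$ is isomorphic to the filtered chain complex $(C^-(G),\partial^-)$ with coefficients in $\mathbb{Z}/2\mathbb{Z}$. In particular $$H_*(\widetilde{C}^-(G)\otimes\mathbb{Z}/2\mathbb{Z})\cong H_*(C^-(G);\mathbb{Z}/2\mathbb{Z}).$$
   Context: Grid diagrams. A grid diagram $G$ of complexity $n$ is an $n\times n$ array of unit squares, placed in the plane as $[0,n]\times[0,n]$, each square being decorated (at its centre) with an $X$, an $O$ or nothing, so that each row and each column contains exactly one $X$ and exactly one $O$. Number the markings: $\mathbb{X}=\{X_i\}_{i=1}^n$, $\mathbb{O}=\{O_i\}_{i=1}^n$. Drawing horizontal segments from the $O$ to the $X$ in each row and vertical segments from the $X$ to the $O$ in each column, verticals passing over horizontals, gives an oriented link $\overrightarrow{L}$. Number its components from $1$ to $l$; let $\mathbb{O}_i\subset\mathbb{O}$, $\mathbb{X}_i\subset\mathbb{X}$ be the markings on the $i$-th component and $n_i$ the number of horizontal segments on it. Identify opposite sides of the square to get an oriented torus $\mathcal{T}$. Spin extension. $\mathfrak{S}_n$ is the group of bijections of $\{0,\dots,n-1\}$, with product $(x.y)(i)=x(y(i))$, $\tau_{i,j}$ is the transposition of $i$ and $j$, and $\tau_i=\tau_{i,i+1}$. $\widetilde{\mathfrak{S}}_n$ is the group with generators $\widetilde{\tau}_0,\dots,\widetilde{\tau}_{n-2},z$ and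 relations $z^2=1$, $z\widetilde{\tau}_i=\widetilde{\tau}_iz$, $\widetilde{\tau}_i^2=z$, $\widetilde{\tau}_i\widetilde{\tau}_j=z\widetilde{\tau}_j\widetilde{\tau}_i$ for $|i-j|>1$, $\widetilde{\tau}_i\widetilde{\tau}_{i+1}\widetilde{\tau}_i=\widetilde{\tau}_{i+1}\widetilde{\tau}_i\widetilde{\tau}_{i+1}$. The homomorphism $p:\widetilde{\mathfrak{S}}_n\to\mathfrak{S}_n$ is given by $\widetilde{\tau}_i\mapsto\tau_i$, $z\mapsto 1$; write $\mathbf{x}=p(\widetilde{\mathbf{x}})$. For $i<j$ put $\widetilde{\tau}_{i,j}=\widetilde{\tau}_i\widetilde{\tau}_{i+1}\cdots\widetilde{\tau}_{j-2}\widetilde{\tau}_{j-1}\widetilde{\tau}_{j-2}\cdots\widetilde{\tau}_{i+1}\widetilde{\tau}_i$ and $\widetilde{\tau}_{j,i}=z\widetilde{\tau}_{i,j}$. Gradings. $\mathbf{x}\in\mathfrak{S}_n$ is identified with its graph, the set of points $(i,\mathbf{x}(i))$, $0\le i\le n-1$. For finite sets $A,B$ of points in the plane, $\mathcal{I}(A,B)$ is the number of pairs $(a_1,a_2)\in A$, $(b_1,b_2)\in B$ with $a_1<b_1$ and $a_2<b_2$; $\mathcal{J}(A,B)=(\mathcal{I}(A,B)+\mathcal{I}(B,A))/2$, extended bilinearly to formal sums and differences. The Maslov degree is $M(\mathbf{x})=\mathcal{J}(\mathbf{x}-\mathbb{O},\mathbf{x}-\mathbb{O})+1$. The Alexander filtration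 level is $A(\mathbf{x})=(A_1(\mathbf{x}),\dots,A_l(\mathbf{x}))$ with $A_i(\mathbf{x})=\mathcal{J}(\mathbf{x}-\frac12(\mathbb{X}+\mathbb{O}),\mathbb{X}_i-\mathbb{O}_i)-\frac{n_i-1}{2}$. Put $M(\widetilde{\mathbf{x}})=M(\mathbf{x})$, $A(\widetilde{\mathbf{x}})=A(\mathbf{x})$. Each variable $U_{O_j}$ has Maslov degree $-2$ and $A(U_{O_j})=(0,\dots,0,-1,0,\dots,0)$ with $-1$ in position $i$ if $O_j$ lies on the $i$-th component; both are additive under multiplication by monomials. Filtration levels carry the componentwise partial order. Rectangles. For $\mathbf{x}\in\mathfrak{S}_n$ and an ordered pair $i\ne j$, there is a rectangle $r$ from $\mathbf{x}$ to $\mathbf{y}=\mathbf{x}.\tau_{i,j}$, embedded in $\mathcal{T}$ with bottom left corner $(i,\mathbf{x}(i))$ and top right corner $(j,\mathbf{x}(j))$ (going rightwards from column $i$ to column $j$ and upwards from $\mathbf{x}(i)$ to $\mathbf{x}(j)$, cyclically). These are all the rectangles from $\mathbf{x}$ to $\mathbf{y}$ (the pairs $(i,j)$ and $(j,i)$ give two). It is empty if its interior contains no point of $\mathbf{x}$; $\mathrm{Rect}^\circ(\mathbf{x},\mathbf{y})$ is the set of empty rectangles from $\mathbf{x}$ to $\mathbf{y}$, and $O_k(r)$ is the number of times $O_k$ appears in the interior of $r$. At the level of $\widetilde{\mathfrak{S}}_n$, $\widetilde{\tau}_{i,j}$ is regarded as a rectangle $\widetilde r$ from $\widetilde{\mathbf{x}}$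 to $\widetilde{\mathbf{y}}=\widetilde{\mathbf{x}}.\widetilde{\tau}_{i,j}$, whose corresponding rectangle $r$ in $\mathcal{T}$ is the one given by $\mathbf{x}$ and $(i,j)$; $\widetilde r$ is empty if $r$ is, $O_k(\widetilde r)=O_k(r)$, and $\mathrm{Rect}^\circ(\widetilde{\mathbf{x}},\widetilde{\mathbf{y}})$ is the set of empty rectangles from $\widetilde{\mathbf{x}}$ to $\widetilde{\mathbf{y}}$. Complexes. With $\Lambda=\mathbb{Z}[U_{O_1},\dots,U_{O_n}]$, $\widetilde{C}^-(G)=\Lambda[\widetilde{\mathfrak{S}}_n]/\langle z+1\rangle$ is the quotient of the free $\Lambda$-module on $\widetilde{\mathfrak{S}}_n$ by the submodule generated by $z+1$ (so $z\widetilde{\mathbf{x}}=-\widetilde{\mathbf{x}}$), with $\Lambda$-linear differential $$\widetilde{\partial}^-\widetilde{\mathbf{x}}=\sum_{\widetilde{\mathbf{y}}\in\widetilde{\mathfrak{S}}_n}\ \sum_{\widetilde r\in\mathrm{Rect}^\circ(\widetilde{\mathbf{x}},\widetilde{\mathbf{y}})}U_{O_1}^{O_1(\widetilde r)}\cdots U_{O_n}^{O_n(\widetilde r)}\,\widetilde{\mathbf{y}}.$$ $C^-(G)$ with coefficients in $\mathbb{Z}/2\mathbb{Z}$ is the free $(\mathbb{Z}/2\mathbb{Z})[U_{O_1},\dots,U_{O_n}]$-module on $\mathfrak{S}_n$ with linear differential $$\partial^-\mathbf{x}=\sum_{\mathbf{y}\in\mathfrak{S}_n}\ \sum_{r\in\mathrm{Rect}^\circ(\mathbf{x},\mathbf{y})}U_{O_1}^{O_1(r)}\cdots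 U_{O_n}^{O_n(r)}\,\mathbf{y}.$$ Both are graded by $M$ and filtered by $A$; an isomorphism of filtered complexes is an isomorphism of chain complexes respecting the grading and the filtration in both directions. *)

(* Defs.v *)
From HB Require Import structures.
From mathcomp Require Import all_boot all_order all_fingroup all_algebra.
From mathcomp Require Import generic_quotient ring_quotient.
From mathcomp Require Import boolp classical_sets cardinality fsbigop.
From mathcomp.multinomials Require Import freeg mpoly.
From mathcomp Require Import zify.

Set Implicit Arguments.
Unset Strict Implicit.
Unset Printing Implicit Defensive.

Import Order.TTheory GRing.Theory Num.Theory.
Local Open Scope ring_scope.
Local Open Scope quotient_scope.

Section Span.
Variables (R : nzRingType) (V : lmodType R) (S : V -> Prop).

(* The submodule of V generated by S. *)
Inductive span : V -> Prop :=
| span0 : span 0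
| spanZD a u v : S u -> span v -> span (a *: u + v).

Definition spanb : {pred V} := fun v => `[< span v >].

Lemma spanD u v : span u -> span v -> span (u + v).
Proof.
elim=> [|a w t Sw _ IH] sv; first by rewrite add0r.
by rewrite -addrA; apply: spanZD => //; apply: IH.
Qed.

Lemma spanZ a v : span v -> span (a *: v).
Proof.
elim=> [|b u w Su _ IH]; first by rewrite scaler0; apply: span0.
by rewrite scalerDr scalerA; apply: spanZD.
Qed.

Lemma span_gen u : S u -> span u.
Proof. by move=> Su; rewrite -[u]addr0 -[u]scale1r; apply/spanZD/span0. Qed.

Lemma spanb_closed : submod_closed spanb.
Proof.
split=> [|a u v /asboolP su /asboolP sv]; apply/asboolP; first exact: span0.
by apply: spanD => //; apply: spanZ.
Qed.

HB.instance Definition _ := GRing.isSubmodClosed.Build R V spanb spanb_closed.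

(* V / span S *)
Definition quotmod := Quotient.quot spanb.

HB.instance Definition _ := Choice.on quotmod.
HB.instance Definition _ := GRing.Zmodule.on quotmod.
HB.instance Definition _ := EqQuotient.on quotmod.

Definition qproj (v : V) : quotmod := \pi_(Quotient.quot spanb) v.

Lemma qprojP u v : qproj u = qproj v <-> span (u - v).
Proof.
split=> [/eqP|suv]; first by rewrite -Quotient.idealrBE => /asboolP.
by apply/eqP; rewrite -Quotient.idealrBE; apply/asboolP.
Qed.

Definition qrepr (q : quotmod) : V := repr (q : Quotient.quot spanb).

Lemma qreprK : cancel qrepr qproj.
Proof. by move=> q; rewrite /qproj /qrepr reprK. Qed.

Definition qscale a (q : quotmod) : quotmod := qproj (a *: qrepr q).

Lemma qscaleE a v : qscale a (qproj v) = qproj (a *: v).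
Proof.
apply/qprojP; rewrite -scalerBr; apply: spanZ.
by apply/qprojP; rewrite qreprK.
Qed.

Lemma qprojD u v : qproj (u + v) = qproj u + qproj v.
Proof. exact: (raddfD (\pi_(Quotient.quot spanb))). Qed.

Fact qscaleA a b q : qscale a (qscale b q) = qscale (a * b) q.
Proof. by rewrite -[q]qreprK !qscaleE scalerA. Qed.
Fact qscale1 : left_id 1 qscale.
Proof. by move=> q; rewrite -[q]qreprK qscaleE scale1r. Qed.
Fact qscaleDr : right_distributive qscale +%R.
Proof.
move=> a p q; rewrite -[p]qreprK -[q]qreprK.
by rewrite -qprojD !qscaleE -qprojD scalerDr.
Qed.
Fact qscaleDl q : {morph qscale^~ q : a b / a + b}.
Proof. by move=> a b; rewrite -[q]qreprK !qscaleE -qprojD scalerDl. Qed.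

HB.instance Definition _ :=
  GRing.Zmodule_isLmodule.Build R quotmod qscaleA qscale1 qscaleDr qscaleDl.

Fact qproj_linear : linear qproj.
Proof. by move=> a u v; rewrite qprojD -qscaleE. Qed.
HB.instance Definition _ := GRing.isLinear.Build R V quotmod *:%R qproj
  qproj_linear.

(* The factorisation through V / span S of a linear map that kills S; it does
   not satisfy its defining equation if f does not kill S. *)
Definition qlift (W : lmodType R) (f : V -> W) (q : quotmod) : W := f (qrepr q).

Lemma qliftE (W : lmodType R) (f : {linear V -> W}) v :
  (forall u, S u -> f u = 0) -> qlift f (qproj v) = f v.
Proof.
move=> fS; have kill u : span u -> f u = 0.
  by elim=> [|a w t Sw _ IH]; rewrite ?linear0 // linearP IH fS // scaler0 addr0.
apply/eqP; rewrite -subr_eq0 -linearB; apply/eqP/kill/qprojP.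
by rewrite qreprK.
Qed.

Lemma qlift_linear (W : lmodType R) (f : {linear V -> W}) :
  (forall u, S u -> f u = 0) -> linear (qlift f).
Proof.
move=> fS a p q; rewrite -[p]qreprK -[q]qreprK -linearP.
by rewrite !(qliftE _ fS) linearP.
Qed.

End Span.

Arguments qproj {R V} S v.

Section FreeLift.
Variables (R : nzRingType) (K : choiceType) (W : lmodType R) (f : K -> W).

Lemma fgliftE (D : {freeg K / R}) :
  fglift f D = \sum_(x <- dom D) coeff x D *: f x.
Proof.
have add := @lift_is_additive R K W f.
have h0 : fglift f 0 = 0 by rewrite -[X in fglift f X](subrr 0) add subrr.
have hD u v : fglift f (u + v) = fglift f u + fglift f v.
  by rewrite -{1}[v]opprK -[- v]sub0r !add h0 sub0r opprK.
rewrite -{1}[D]freeg_sumE (big_morph _ hD h0).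
by apply: eq_bigr => x _; rewrite liftU.
Qed.

Fact fglift_linear : linear (fglift f : {freeg K / R} -> W).
Proof.
have add := @lift_is_additive R K W f.
have h0 : fglift f 0 = 0 by rewrite -[X in fglift f X](subrr 0) add subrr.
have hD u v : fglift f (u + v) = fglift f u + fglift f v.
  by rewrite -{1}[v]opprK -[- v]sub0r !add h0 sub0r opprK.
move=> a u v; rewrite hD; congr (_ + _).
rewrite -{1}[u]freeg_sumE scaler_sumr (big_morph _ hD h0) fgliftE scaler_sumr.
apply: eq_bigr => x _; rewrite scalerA -(liftU f (a * _)); congr (fglift f _).
by apply/eqP/freeg_eqP => y; rewrite coeffZ !coeffU mulrA.
Qed.
HB.instance Definition _ := GRing.isLinear.Build R {freeg K / R} W *:%R
  (fglift f) fglift_linear.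
End FreeLift.

(* M (x)_Z N, constructed as the free abelian group on M * N modulo bilinearity. *)
Section Tensor.
Variables (R : nzRingType) (M : lmodType R) (N : zmodType).

Notation pairs := {freeg (M * N)%type / int}.

Inductive bilin_rel : pairs -> Prop :=
| BilinL m m' k : bilin_rel (<< (m + m', k) >> - << (m, k) >> - << (m', k) >>)
| BilinR m k k' : bilin_rel (<< (m, k + k') >> - << (m, k) >> - << (m, k') >>).

Definition tensorZ := quotmod bilin_rel.

HB.instance Definition _ := GRing.Zmodule.on tensorZ.

Definition tens (m : M) (k : N) : tensorZ := qproj bilin_rel << (m, k) >>.

Lemma tensDl m m' k : tens (m + m') k = tens m k + tens m' k.
Proof.
apply/eqP; rewrite -subr_eq0 opprD addrA -!linearB -[0](linear0 (qproj bilin_rel)).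
by apply/eqP/qprojP; rewrite subr0; apply/span_gen/BilinL.
Qed.

Lemma tensDr m k k' : tens m (k + k') = tens m k + tens m k'.
Proof.
apply/eqP; rewrite -subr_eq0 opprD addrA -!linearB -[0](linear0 (qproj bilin_rel)).
by apply/eqP/qprojP; rewrite subr0; apply/span_gen/BilinR.
Qed.


Lemma tensorZE (t : tensorZ) :
  t = \sum_(p <- dom (qrepr t)) tens p.1 p.2 *~ coeff p (qrepr t).
Proof.
rewrite -{1}[t]qreprK -{1}[qrepr t]freeg_sumE raddf_sum /=.
apply: eq_bigr => -[m k] _; rewrite /tens -raddfMz /=.
by congr (qproj _ _); rewrite freegU_mulz intz.
Qed.

Lemma tensorZ_ind (P : tensorZ -> Prop) :
  P 0 -> (forall m k t, P t -> P (tens m k + t)) -> forall t, P t.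
Proof.
move=> P0 PD t.
have PDn m k j u : P u -> P (tens m k *+ j + u).
  by elim: j => [|j IH] Pu; rewrite ?mulr0n ?add0r // mulrS -addrA; apply/PD/IH.
have tens0 k : tens 0 k = 0.
  by apply: (addrI (tens 0 k)); rewrite -tensDl !addr0.
have tensN m k : - tens m k = tens (- m) k.
  by apply: (addrI (tens m k)); rewrite -tensDl !subrr tens0.
rewrite [t]tensorZE; elim: (dom _) => [|[m k] s IH]; first by rewrite big_nil.
rewrite big_cons; case: (coeff _ _) => j; first by rewrite -pmulrn; apply: PDn.
by rewrite NegzE mulrNz -pmulrn -mulNrn tensN; apply: PDn.
Qed.
End Tensor.

Arguments tensorZ {R} M N.
Arguments tens {R M N} m k.

(* f (x) id *)
Section TensorMap.
Variables (R : nzRingType) (M M' : lmodType R) (N : zmodType).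

Definition tmap (f : M -> M') : tensorZ M N -> tensorZ M' N :=
  qlift (fglift (fun p : M * N =>
    tens (f p.1) p.2 : quotmod (@bilin_rel R M' N))).

Variable f : {additive M -> M'}.

Fact tmap_kill u : bilin_rel u -> fglift (fun p : M * N =>
    tens (f p.1) p.2 : quotmod (@bilin_rel R M' N)) u = 0.
Proof.
by case=> *; rewrite !linearB /= !liftU !scale1r /= ?raddfD ?tensDl ?tensDr
  addrAC addrK subrr.
Qed.

Lemma tmapE m k : tmap f (tens m k) = tens (f m) k.
Proof. by rewrite /tmap /tens (qliftE _ tmap_kill) /= liftU scale1r. Qed.

Fact tmap_additive : zmod_morphism (tmap f).
Proof.
have l := qlift_linear tmap_kill; move=> p q.
by rewrite /tmap addrC -[- q](@scaleN1r _ (quotmod (@bilin_rel R M N)))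
  l scaleN1r addrC.
Qed.
HB.instance Definition _ := GRing.isZmodMorphism.Build (tensorZ M N)
  (tensorZ M' N) (tmap f) tmap_additive.
End TensorMap.

Section TensorModule.
Variables (R : nzRingType) (M : lmodType R) (N : zmodType).

(* R acts on the left factor. *)
Definition tscale (a : R) : tensorZ M N -> tensorZ M N := tmap ( *:%R a).

Fact tscaleA a b t : tscale a (tscale b t) = tscale (a * b) t.
Proof.
elim/tensorZ_ind: t => [|m k t IH]; rewrite /tscale ?raddf0 // !raddfD /=.
by rewrite !tmapE /= scalerA; congr (_ + _).
Qed.
Fact tscale1 : left_id 1 tscale.
Proof.
by elim/tensorZ_ind => [|m k t IH]; rewrite /tscale ?raddf0 // raddfD /= tmapE
  /= scale1r; congr (_ + _).
Qed.
Fact tscaleDr : right_distributive tscale +%R.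
Proof. by move=> a s t; rewrite /tscale raddfD. Qed.
Fact tscaleDl t : {morph tscale^~ t : a b / a + b}.
Proof.
move=> a b; elim/tensorZ_ind: t => [|m k t IH].
  by rewrite /tscale !raddf0 addr0.
rewrite /tscale !raddfD /= !tmapE /= scalerDl tensDl addrACA; congr (_ + _).
exact: IH.
Qed.
HB.instance Definition _ := GRing.Zmodule_isLmodule.Build R (tensorZ M N)
  tscaleA tscale1 tscaleDr tscaleDl.
End TensorModule.

Lemma tmap_scale (R : nzRingType) (M M' : lmodType R) (N : zmodType)
  (f : {linear M -> M'}) a (t : tensorZ M N) :
  tmap f (tscale a t) = tscale a (tmap f t).
Proof.
elim/tensorZ_ind: t => [|m k t IH]; first by rewrite /tscale !raddf0.
by move: IH; rewrite /tscale !raddfD /= !tmapE /= linearZ => ->.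
Qed.

Fact tmap_linear (R : nzRingType) (M M' : lmodType R) (N : zmodType)
  (f : {linear M -> M'}) : linear (@tmap R M M' N f).
Proof. by move=> a s t; rewrite raddfD /= (tmap_scale f a s). Qed.
HB.instance Definition _ (R : nzRingType) (M M' : lmodType R) (N : zmodType)
  (f : {linear M -> M'}) :=
  GRing.isLinear.Build R (tensorZ M N) (tensorZ M' N) *:%R (tmap f)
    (tmap_linear f).

Section Homology.
Variables (R : nzRingType) (C : lmodType R) (d : {linear C -> C}).

Definition kerb : {pred C} := fun v => d v == 0.

Fact kerb_closed : submod_closed kerb.
Proof.
split=> [|a u v /eqP du /eqP dv]; first by rewrite unfold_in linear0.
by rewrite unfold_in linearP du dv scaler0 addr0.
Qed.
HB.instance Definition _ := GRing.isSubmodClosed.Build R C kerb kerb_closed.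

Record cycle := Cycle { cycle_val :> C; cycleP : cycle_val \in kerb }.
HB.instance Definition _ := [isSub for cycle_val].
HB.instance Definition _ := [Choice of cycle by <:].
HB.instance Definition _ := [SubChoice_isSubLmodule of cycle by <:].

Definition boundary (c : cycle) : Prop := exists b : C, (c : C) = d b.

(* ker d / (ker d :&: im d), that is ker d / im d when d \o d = 0. *)
Definition homology := quotmod boundary.

HB.instance Definition _ := GRing.Lmodule.on homology.

Definition hclass (c : cycle) : homology := qproj boundary c.
End Homology.

(* A module with an endomorphism (the differential), a grading, given by its
   homogeneous parts, and a filtration indexed by l-tuples of numbers.  The
   gradings and filtrations below are given by formulas with halves in them, and
   are therefore indexed by rationals. *)
Record fcomplex (R : nzRingType) (l : nat) := FComplex {
  fc_mod :> lmodType R;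
  fc_diff : {linear fc_mod -> fc_mod};
  fc_homog : rat -> fc_mod -> Prop;
  fc_level : ('I_l -> rat) -> fc_mod -> Prop
}.

Arguments fc_diff {R l} f.
Arguments fc_homog {R l} f d v.
Arguments fc_level {R l} f s v.

Definition fc_homology (R : nzRingType) (l : nat) (C : fcomplex R l) :=
  homology (fc_diff C).

(* The classes of the homogeneous cycles of degree k. *)
Definition homology_homog (R : nzRingType) (l : nat) (C : fcomplex R l)
    (k : rat) (h : fc_homology C) : Prop :=
  exists2 c : cycle (fc_diff C), fc_homog C k c & h = hclass c.

(* The subgroup of M (x)_Z N generated by the v (x) k with v in P, i.e. the image
   of P (x)_Z N. *)
Inductive tens_sub (R : nzRingType) (M : lmodType R) (N : zmodType)
    (P : M -> Prop) : tensorZ M N -> Prop :=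
| TensSub0 : tens_sub P 0
| TensSubD v k t : P v -> tens_sub P t -> tens_sub P (tens v k + t).

Definition fc_tensor (R : nzRingType) (l : nat) (C : fcomplex R l)
    (N : zmodType) : fcomplex R l :=
  @FComplex R l (tensorZ C N) (tmap (fc_diff C))
    (fun k => tens_sub (fc_homog C k)) (fun s => tens_sub (fc_level C s)).

(* C is a complex over R and D one over R'; the isomorphisms are linear along
   nu : R -> R'. *)
Definition fc_isomorphic (R R' : nzRingType) (l : nat)
    (C : fcomplex R l) (D : fcomplex R' l) (nu : {rmorphism R -> R'}) : Prop :=
  exists f : {linear C -> D | nu \; *:%R},
  [/\ bijective f,
      forall v, f (fc_diff C v) = fc_diff D (f v),
      forall k v, fc_homog C k v <-> fc_homog D k (f v)
    & forall s v, fc_level C s v <-> fc_level D s (f v)].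

Definition homology_isomorphic (R R' : nzRingType) (l : nat)
    (C : fcomplex R l) (D : fcomplex R' l) (nu : {rmorphism R -> R'}) : Prop :=
  exists f : {linear fc_homology C -> fc_homology D | nu \; *:%R},
  bijective f /\
  forall k h, homology_homog k h <-> homology_homog k (f h).

(* (a, b) is the square in column a and row b, with centre (a + 1/2, b + 1/2).
   The markings X_i and O_i are numbered arbitrarily: X_i and O_i need not share
   a row or a column. *)
Record grid (n : nat) := Grid {
  gX : 'I_n -> 'I_n * 'I_n;
  gO : 'I_n -> 'I_n * 'I_n;
  gX_col : bijective (fun i => (gX i).1);
  gX_row : bijective (fun i => (gX i).2);
  gO_col : bijective (fun i => (gO i).1);
  gO_row : bijective (fun i => (gO i).2);
  gX_neq_gO : forall i j, gX i != gO j
}.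

(* inl i stands for X_i, inr i for O_i. *)
Definition marking (n : nat) := ('I_n + 'I_n)%type.

Definition square n (G : grid n) (m : marking n) : 'I_n * 'I_n :=
  match m with inl i => gX G i | inr i => gO G i end.

(* Two markings in the same row, or in the same column, are the ends of a segment
   of the link. *)
Definition segment n (G : grid n) : rel (marking n) :=
  [rel a b | ((square G a).1 == (square G b).1)
          || ((square G a).2 == (square G b).2)].

(* A numbering of the components of the link: lc i says on which one each marking
   lies. *)
Record components n (G : grid n) (l : nat) := Components {
  lc : marking n -> 'I_l;
  lc_surj : forall c, exists m, lc m = c;
  lcP : forall a b, (lc a == lc b) = connect (segment G) a b
}.

Definition pt := (rat * rat)%type.

Definition center n (s : 'I_n * 'I_n) : pt :=
  ((s.1 : nat)%:R + 2^-1, (s.2 : nat)%:R + 2^-1).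

(* Formal combinations of points; a finite set of points is the sum of its
   elements. *)
Definition Icount (A B : {freeg pt / rat}) : rat :=
  \sum_(a <- dom A) \sum_(b <- dom B)
    coeff a A * coeff b B * ((a.1 < b.1) && (a.2 < b.2))%:R.

Definition Jcount (A B : {freeg pt / rat}) : rat :=
  (Icount A B + Icount B A) / 2.

Section Degrees.
Variables (n : nat) (G : grid n) (l : nat) (L : components G l).

Definition gpt (x : 'S_n) (i : 'I_n) : pt := ((i : nat)%:R, (x i : nat)%:R).

Definition graph (x : 'S_n) : {freeg pt / rat} := \sum_(i < n) << gpt x i >>.

Definition Xcomp (c : 'I_l) : {freeg pt / rat} :=
  \sum_(i < n | lc L (inl i) == c) << center (gX G i) >>.
Definition Ocomp (c : 'I_l) : {freeg pt / rat} :=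
  \sum_(i < n | lc L (inr i) == c) << center (gO G i) >>.
Definition Xall : {freeg pt / rat} := \sum_(i < n) << center (gX G i) >>.
Definition Oall : {freeg pt / rat} := \sum_(i < n) << center (gO G i) >>.

(* There is one horizontal segment in each row, and it starts at an O. *)
Definition nhoriz (c : 'I_l) : nat := #|[set i | lc L (inr i) == c]|.

Definition Maslov (x : 'S_n) : rat :=
  Jcount (graph x - Oall) (graph x - Oall) + 1.

Definition Alexander (x : 'S_n) (c : 'I_l) : rat :=
  Jcount (graph x - 2^-1 *: (Xall + Oall)) (Xcomp c - Ocomp c)
  - ((nhoriz c)%:R - 1) / 2.

(* The monomial m stands for the product of the U_{O_j} ^ (m j). *)
Definition MaslovU (m : 'X_{1..n}) : rat := \sum_(j < n) (-2) *+ m j.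
Definition AlexanderU (m : 'X_{1..n}) (c : 'I_l) : rat :=
  \sum_(j < n) (if lc L (inr j) == c then -1 else 0) *+ m j.
End Degrees.

(* The grading and the filtration of the free R[U_{O_1}, ..., U_{O_n}]-module on
   a set K whose elements have been given a degree M and a level A: a vector is
   homogeneous, resp. of level s, if all the terms U^m x occurring in it are. *)
Section FreeComplex.
Variables (n : nat) (G : grid n) (l : nat) (L : components G l).
Variables (R : nzRingType) (K : choiceType).
Variables (M : K -> rat) (A : K -> 'I_l -> rat).

Definition free_homog (k : rat) (v : {freeg K / {mpoly R[n]}}) : Prop :=
  forall x m, (coeff x v)@_m != 0 -> M x + MaslovU m = k.

Definition free_level (s : 'I_l -> rat) (v : {freeg K / {mpoly R[n]}}) : Prop :=
  forall x m, (coeff x v)@_m != 0 -> forall c, A x c + AlexanderU L m c <= s c.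
End FreeComplex.

(* The product x.y of the symmetric group: (x.y)(i) = x (y i), while the product
   of permutations of the library applies its left factor first. *)
Definition sdot n (x y : 'S_n) : 'S_n := (y * x)%g.

(* The length of the arc going in the positive direction from a to b in the
   circle R / nZ, for a, b in [0, n[. *)
Definition arc (n : nat) (a b : rat) : rat :=
  if a <= b then b - a else b - a + n%:R.

(* p lies in the interior of the rectangle with bottom left corner (i, x i) and
   top right corner (j, x j) on the torus, where r = (i, j) and i != j. *)
Definition in_rect n (x : 'S_n) (r : 'I_n * 'I_n) (p : pt) : bool :=
  let bl := gpt x r.1 in let tr := gpt x r.2 in
  (0 < arc n bl.1 p.1 < arc n bl.1 tr.1) &&
  (0 < arc n bl.2 p.2 < arc n bl.2 tr.2).

Definition empty_rect n (x : 'S_n) (r : 'I_n * 'I_n) : bool :=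
  [forall k, ~~ in_rect x r (gpt x k)].

(* Rect^o(x, y) *)
Definition rects n (x y : 'S_n) : {set 'I_n * 'I_n} :=
  [set r | [&& r.1 != r.2, y == sdot x (tperm r.1 r.2) & empty_rect x r]].

(* The product of the U_{O_k} ^ O_k(r). *)
Definition rect_mon (R : nzRingType) n (G : grid n) (x : 'S_n)
    (r : 'I_n * 'I_n) : {mpoly R[n]} :=
  \prod_(k < n) 'X_k ^+ in_rect x r (center (gO G k)).

Section MinusComplex.
Variables (n : nat) (G : grid n) (l : nat) (L : components G l).

Definition dminus_gen (x : 'S_n) : {freeg ('S_n) / {mpoly 'F_2[n]}} :=
  \sum_(y : 'S_n) \sum_(r in rects x y) rect_mon 'F_2 G x r *: << y >>.

Definition Cminus : fcomplex {mpoly 'F_2[n]} l :=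
  @FComplex _ l {freeg ('S_n) / {mpoly 'F_2[n]}} (fglift dminus_gen)
    (free_homog (Maslov G)) (free_level L (Alexander L)).
End MinusComplex.

Section Spin.
Variable n : nat.

(* None stands for z and Some k for the generator of index k, 0 <= k <= n - 2; a
   letter is a generator or, if it is flagged, the inverse of one. *)
Definition sgen := option 'I_n.-1.
Definition sletter := (sgen * bool)%type.
Definition sword := seq sletter.

Notation z := ((None, false) : sletter).
Notation t k := ((Some k, false) : sletter).

Inductive srel : sword -> sword -> Prop :=
| SInv g b : srel [:: (g, b); (g, ~~ b)] [::]
| SZ2 : srel [:: z; z] [::]
| SZC k : srel [:: z; t k] [:: t k; z]
| ST2 k : srel [:: t k; t k] [:: z]
| SFar (j k : 'I_n.-1) : (j.+1 < k)%N || (k.+1 < j)%N ->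
    srel [:: t j; t k] [:: z; t k; t j]
| SBraid (j k : 'I_n.-1) : k = j.+1 :> nat ->
    srel [:: t j; t k; t j] [:: t k; t j; t k].

Inductive scong : sword -> sword -> Prop :=
| SStep u v r s : srel r s -> scong (u ++ r ++ v) (u ++ s ++ v)
| SRefl u : scong u u
| SSym u v : scong u v -> scong v u
| STrans u v w : scong u v -> scong v w -> scong u w.

Definition scongb : rel sword := fun u v => `[< scong u v >].

Fact scongb_refl : reflexive scongb.
Proof. by move=> u; apply/asboolP/SRefl. Qed.
Fact scongb_sym : ssrbool.symmetric scongb.
Proof. by move=> u v; apply/asboolP/asboolP; apply: SSym. Qed.
Fact scongb_trans : transitive scongb.
Proof. by move=> v u w /asboolP uv /asboolP vw; apply/asboolP/(STrans uv vw). Qed.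

Canonical scongb_equiv := EquivRel scongb scongb_refl scongb_sym scongb_trans.
Canonical scongb_encModRel := defaultEncModRel scongb.

Definition spin := {eq_quot scongb}.

HB.instance Definition _ := Choice.on spin.
HB.instance Definition _ := EqQuotient.on spin.

Definition spin_of (u : sword) : spin := \pi_({eq_quot scongb}) u.

Definition spin_repr (q : spin) : sword := repr (q : {eq_quot scongb}).

Lemma spin_reprK : cancel spin_repr spin_of.
Proof. by move=> q; rewrite /spin_of /spin_repr reprK. Qed.

Lemma spinP u v : spin_of u = spin_of v <-> scong u v.
Proof.
split=> [/eqmodP /asboolP // | uv].
by apply/eqmodP/asboolP.
Qed.

Lemma scong_ctx u v w w' : scong w w' -> scong (u ++ w ++ v) (u ++ w' ++ v).
Proof.
elim=> [a b r s rs|a|a b _|a b c _ IH1 _]; first 1 last.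
- exact: SRefl.
- exact: SSym.
- exact: STrans.
by have := SStep (u ++ a) (b ++ v) rs; rewrite -!catA.
Qed.

Lemma scong_cat u u' v v' :
  scong u u' -> scong v v' -> scong (u ++ v) (u' ++ v').
Proof.
move=> uu vv; apply: (@STrans _ (u' ++ v)); first exact: (scong_ctx [::] v uu).
by have := scong_ctx u' [::] vv; rewrite !cats0.
Qed.

Definition sinvw (u : sword) : sword := [seq (a.1, ~~ a.2) | a <- rev u].

Lemma sinvw_catl u : scong (sinvw u ++ u) [::].
Proof.
elim: u => [|[g b] u IH]; first exact: SRefl.
rewrite /sinvw rev_cons map_rcons cat_rcons.
apply: (STrans _ IH).
have := SStep (sinvw u) u (SInv g (~~ b)); rewrite negbK.
by [].
Qed.

Lemma sinvwK u : sinvw (sinvw u) = u.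
Proof.
by rewrite /sinvw -map_rev revK -map_comp map_id_in // => -[g b] _ /=;
  rewrite negbK.
Qed.

Lemma sinvw_catr u : scong (u ++ sinvw u) [::].
Proof. by rewrite -{1}[u]sinvwK; apply: sinvw_catl. Qed.

Lemma scong_inv u v : scong u v -> scong (sinvw u) (sinvw v).
Proof.
move=> uv; apply: (@STrans _ (sinvw u ++ v ++ sinvw v)).
  rewrite -{1}[sinvw u]cats0; apply: scong_cat; first exact: SRefl.
  exact/SSym/sinvw_catr.
rewrite catA -[X in scong _ X]cat0s; apply: scong_cat; last exact: SRefl.
apply: (STrans _ (sinvw_catl u)); apply: scong_cat; first exact: SRefl.
exact: SSym.
Qed.

Definition spin_mul (p q : spin) : spin := spin_of (spin_repr p ++ spin_repr q).
Definition spin_inv (p : spin) : spin := spin_of (sinvw (spin_repr p)).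

Lemma spin_mulE u v : spin_mul (spin_of u) (spin_of v) = spin_of (u ++ v).
Proof. by apply/spinP/scong_cat; apply/spinP; rewrite spin_reprK. Qed.

Lemma spin_invE u : spin_inv (spin_of u) = spin_of (sinvw u).
Proof. by apply/spinP/scong_inv; apply/spinP; rewrite spin_reprK. Qed.

Fact spin_mulA : associative spin_mul.
Proof.
move=> p q r; rewrite -[p]spin_reprK -[q]spin_reprK -[r]spin_reprK.
by rewrite !spin_mulE catA.
Qed.
Fact spin_mul1 : left_id (spin_of [::]) spin_mul.
Proof. by move=> p; rewrite -[p]spin_reprK spin_mulE. Qed.
Fact spin_mulr1 : right_id (spin_of [::]) spin_mul.
Proof. by move=> p; rewrite -[p]spin_reprK spin_mulE cats0. Qed.
Fact spin_mulV : left_inverse (spin_of [::]) spin_inv spin_mul.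
Proof.
move=> p; rewrite -[p]spin_reprK spin_invE spin_mulE.
exact/spinP/sinvw_catl.
Qed.
Fact spin_mulrV : right_inverse (spin_of [::]) spin_inv spin_mul.
Proof.
move=> p; rewrite -[p]spin_reprK spin_invE spin_mulE.
exact/spinP/sinvw_catr.
Qed.

HB.instance Definition _ := isGroup.Build spin
  spin_mulA spin_mul1 spin_mulr1 spin_mulV spin_mulrV.

Definition sz : spin := spin_of [:: z].

(* The generator of index k; the value for k > n - 2 is irrelevant. *)
Definition st (k : nat) : spin :=
  if insub k is Some k' then spin_of [:: t k'] else 1%g.

Definition st_up (i j : nat) : spin :=
  (\prod_(k <- index_iota i j ++ rev (index_iota i j.-1)) st k)%g.

(* For i != j; the value for i = j is irrelevant. *)
Definition stau (r : 'I_n * 'I_n) : spin :=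
  if (r.1 < r.2)%N then st_up r.1 r.2 else (sz * st_up r.2 r.1)%g.

Lemma sz_central (q : spin) : (sz * q = q * sz)%g.
Proof.
rewrite -[q]spin_reprK; elim: (spin_repr q) => [|[g b] u IH] /=.
  by rewrite -[spin_of [::]]/(1%g : spin) mulg1 mul1g.
have -> : spin_of ((g, b) :: u) = (spin_of [:: (g, b)] * spin_of u)%g.
  by rewrite [RHS]spin_mulE.
rewrite -mulgA -IH !mulgA; congr (_ * _)%g.
have key h : (sz * spin_of [:: (h, false)] = spin_of [:: (h, false)] * sz)%g.
  rewrite [LHS]spin_mulE [RHS]spin_mulE; case: h => [k|] //=.
  exact/spinP/(SStep [::] [::] (SZC k)).
case: b; last exact: key.
have -> : spin_of [:: (g, true)] = (spin_of [:: (g, false)])^-1%g.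
  by rewrite [RHS]spin_invE.
by apply: (mulgI (spin_of [:: (g, false)])); rewrite mulgA -key mulgK mulVKg.
Qed.

Definition slo (k : 'I_n.-1) : 'I_n := widen_ord (leq_pred n) k.
Fact shi_subproof (k : 'I_n.-1) : (k.+1 < n)%N.
Proof. by rewrite -ltn_predRL. Qed.
Definition shi (k : 'I_n.-1) : 'I_n := Ordinal (shi_subproof k).

Definition pletter (a : sletter) : 'S_n :=
  let s := if a.1 is Some k then tperm (slo k) (shi k) else 1%g in
  if a.2 then s^-1%g else s.

Definition pword (u : sword) : 'S_n :=
  foldr (fun a s => sdot (pletter a) s) 1%g u.

Lemma pword_cat u v : pword (u ++ v) = sdot (pword u) (pword v).
Proof.
elim: u => [|a u IH] /=; first by rewrite /sdot mulg1.
by rewrite IH /sdot mulgA.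
Qed.

Lemma pword_scong u v : scong u v -> pword u = pword v.
Proof.
elim=> // [{}u {}v r s rs|{}u {}v w _ -> _ ->] //.
rewrite !pword_cat; congr sdot; congr sdot.
case: rs => [g b||k|k|j k jk|j k jk]; rewrite /= /sdot /pletter /= ?mul1g ?mulg1 //.
- by case: b => /=; rewrite ?mulVg ?mulgV.
- exact: tperm2.
- have e : (tperm (slo j) (shi j) ^ tperm (slo k) (shi k) = tperm (slo j) (shi j))%g.
    by rewrite tpermJ !tpermD // -val_eqE /=; case/orP: jk => jk; apply/eqP; lia.
  by rewrite [RHS]conjgC e.
- have ejk : slo k = shi j by apply: val_inj.
  have e1 : (tperm (slo j) (shi j) ^ tperm (slo k) (shi k) = tperm (slo j) (shi k))%g.
    by rewrite tpermJ ejk tpermL tpermD // -val_eqE /=; lia.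
  have e2 : (tperm (slo k) (shi k) ^ tperm (slo j) (shi j) = tperm (slo j) (shi k))%g.
    by rewrite tpermJ ejk tpermR tpermD // -val_eqE /=; lia.
  by move: e1; rewrite -e2 !conjgE !tpermV !mulgA => ->.
Qed.

(* The homomorphism p; see sprojE, sprojM, sproj_z and sproj_t. *)
Definition sproj (q : spin) : 'S_n := pword (spin_repr q).

Lemma sprojE u : sproj (spin_of u) = pword u.
Proof. by apply/pword_scong/spinP; rewrite spin_reprK. Qed.

Lemma sprojM (p q : spin) : sproj (p * q)%g = sdot (sproj p) (sproj q).
Proof.
by rewrite -[p]spin_reprK -[q]spin_reprK [(_ * _)%g]spin_mulE !sprojE pword_cat.
Qed.

Lemma sproj_z : sproj sz = 1%g.
Proof. by rewrite sprojE /= /sdot mulg1. Qed.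

Lemma sproj_t (k : 'I_n.-1) : sproj (st k) = tperm (slo k) (shi k).
Proof. by rewrite /st valK sprojE /= /sdot mul1g. Qed.
End Spin.

Section SpinComplex.
Variables (n : nat) (G : grid n) (l : nat) (L : components G l).

(* Rect^o(x, y) for x and y in the spin extension. *)
Definition srects (x y : spin n) : {set 'I_n * 'I_n} :=
  [set r | [&& r.1 != r.2, y == (x * stau r)%g & empty_rect (sproj x) r]].

(* The sum over y is finite, as srects x y is empty unless y is one of the
   x * stau r: see dspin_genE. *)
Definition dspin_gen (x : spin n) : {freeg (spin n) / {mpoly int[n]}} :=
  \sum_(y \in [set: spin n]%classic)
    \sum_(r in srects x y) rect_mon int G (sproj x) r *: << y >>.

Lemma dspin_genE x : dspin_gen x =
  \sum_(r | (r.1 != r.2) && empty_rect (sproj x) r)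
    rect_mon int G (sproj x) r *: << (x * stau r)%g >>.
Proof.
pose s := undup [seq (x * stau r)%g | r <- enum {: 'I_n * 'I_n}].
have s_stau r : (x * stau r)%g \in s by rewrite mem_undup; apply: map_f; rewrite mem_enum.
rewrite /dspin_gen (fsbigE s) ?undup_uniq // => [|y _ yNs]; last first.
  rewrite big1 // => r; rewrite inE => /and3P[_ /eqP ey _].
  by rewrite ey s_stau in yNs.
rewrite (exchange_big_dep (fun r => (r.1 != r.2) && empty_rect (sproj x) r)) /=;
  last by move=> y r _; rewrite inE => /and3P[-> _ ->].
apply: eq_bigr => r /andP[r12 er].
rewrite (eq_bigl (pred1 (x * stau r)%g)) => [|y]; last first.
  by rewrite !inE mem_setT r12 er andbT.
by rewrite -big_filter filter_pred1_uniq ?undup_uniq // big_seq1.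
Qed.

(* The submodule generated by z + 1 is spanned by the z x + x. *)
Inductive zrel : {freeg (spin n) / {mpoly int[n]}} -> Prop :=
| ZRel x : zrel (<< (sz n * x)%g >> + << x >>).

Definition Cspin_mod := quotmod zrel.
HB.instance Definition _ := GRing.Lmodule.on Cspin_mod.

Definition dspin_free (v : {freeg (spin n) / {mpoly int[n]}}) : Cspin_mod :=
  qproj zrel (fglift dspin_gen v).

Fact dspin_free_linear : linear dspin_free.
Proof. by move=> a u v; rewrite /dspin_free !linearP. Qed.
HB.instance Definition _ := GRing.isLinear.Build _ _ _ _ dspin_free
  dspin_free_linear.

Fact dspin_free_kill u : zrel u -> dspin_free u = 0.
Proof.
case=> x; rewrite /dspin_free (linearD (fglift dspin_gen)) /= !liftU !scale1r.
rewrite !dspin_genE sprojM sproj_z [sdot _ _]mulg1 -big_split linear_sum /=.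
apply: big1 => r _; rewrite -scalerDr linearZ -mulgA /=.
rewrite -[0](scaler0 _ (rect_mon int G (sproj x) r)); congr (_ *: _).
rewrite -[0](linear0 (qproj zrel)); apply/qprojP; rewrite subr0.
exact/span_gen/ZRel.
Qed.

Definition dspin : Cspin_mod -> Cspin_mod := qlift dspin_free.

Lemma dspinE v : dspin (qproj zrel v) = qproj zrel (fglift dspin_gen v).
Proof. exact/qliftE/dspin_free_kill. Qed.

Fact dspin_linear : linear dspin.
Proof. exact/qlift_linear/dspin_free_kill. Qed.
HB.instance Definition _ := GRing.isLinear.Build _ _ _ _ dspin dspin_linear.

Definition qimage (P : {freeg (spin n) / {mpoly int[n]}} -> Prop)
  (q : Cspin_mod) : Prop := exists2 v, P v & q = qproj zrel v.

Definition Cspin : fcomplex {mpoly int[n]} l :=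
  @FComplex _ l Cspin_mod dspin
    (fun k => qimage (free_homog (fun x => Maslov G (sproj x)) k))
    (fun s => qimage (free_level L (fun x => Alexander L (sproj x)) s)).
End SpinComplex.

Arguments Cminus {n} G {l} L.
Arguments Cspin {n} G {l} L.

(* Reduction of the coefficients modulo 2. *)
Definition reduction n : {rmorphism {mpoly int[n]} -> {mpoly 'F_2[n]}} :=
  map_mpoly (intmul 1 : int -> 'F_2).

(* Main.v *)
Require Import Defs.
From HB Require Import structures.
From mathcomp Require Import all_boot all_order all_fingroup all_algebra.
From mathcomp Require Import boolp.
From mathcomp.multinomials Require Import freeg mpoly.
From mathcomp Require Import zify.
Import Defs.
Import Order.TTheory GRing.Theory Num.Theory.
Local Open Scope ring_scope.

Set Implicit Arguments.
Unset Strict Implicit.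
Unset Printing Implicit Defensive.

(** Reducing modulo 2 turns the relation z x = - x into z x = x, so the
spin complex modulo 2 should be the free module on the quotient of the spin
extension by z, which is the symmetric group; the signs carried by the lifts
of the rectangles disappear at the same time.

The content is that p is surjective and that its kernel is contained in {1, z},
i.e. that killing z in the spin extension leaves nothing more than the Coxeter
presentation of the symmetric group ([sproj_ker]).  This is proved with the
usual normal form: every element of the subgroup generated by z and the first
m + 1 generators is h times a descending product of consecutive generators,
where h lies in the subgroup generated by z and the first m
([parabolic_coset]).  An element over the identity fixes m + 1,
which forces the descending product to be empty, and one descends on m.
Surjectivity comes from the fact that the lift of the rectangle (i, j) lies over
the transposition of i and j ([sproj_stau]); the same fact matches the two
differentials term by term ([project_dspin]).

The map [compare] sends U^m x (x) k to k U^m p(x), with coefficients reduced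
modulo 2.  It is well defined because z x + x goes to 2 p(x) = 0.  Choosing one
element of the spin extension over each permutation, every tensor can be written
with these representatives only ([tensor_expand]), the coefficients being
integral polynomials; if the image vanishes they are all even, and an even
element tensored with 1 is zero, so that [compare] is injective.  It is
surjective because coefficients lift from Z/2 to Z.  The lift does not enlarge
the support of a polynomial, and M and A factor through p, so homogeneous parts
and filtration levels correspond in both directions ([compare_supported]).

An isomorphism of complexes which is linear along a ring morphism carries cycles
to cycles and boundaries to boundaries, hence induces the isomorphism on
homology ([fc_isomorphic_homology]). *)

Lemma bijective_of_inj_surj (T U : Type) (f : T -> U) :
  injective f -> (forall y, exists x, f x = y) -> bijective f.
Proof.
by move=> f_inj /choice [g fK]; exists g => // x; apply: f_inj.
Qed.

(** * Restriction of scalars and maps out of a tensor product *)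

(** The target of a map which is linear along nu is regarded as a module over the
source ring, so that the constructions of linear maps over a single ring (on a
free module, on a quotient) apply to such maps. *)
Definition restrict_scalars (R R' : nzRingType) (nu : {rmorphism R -> R'})
  (V : lmodType R') : Type := V.

Section Restriction.
Variables (R R' : nzRingType) (nu : {rmorphism R -> R'}) (V : lmodType R').

Local Notation restrict_scalars := (restrict_scalars nu V).

HB.instance Definition _ := GRing.Zmodule.on restrict_scalars.

Definition scale_along (a : R) (v : restrict_scalars) : restrict_scalars :=
  nu a *: (v : V).

Fact scale_alongA a b v :
  scale_along a (scale_along b v) = scale_along (a * b) v.
Proof. by rewrite /scale_along rmorphM -scalerA. Qed.
Fact scale_along1 : left_id 1 scale_along.
Proof. by move=> v; rewrite /scale_along rmorph1; apply: scale1r. Qed.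
Fact scale_alongDr : right_distributive scale_along +%R.
Proof. by move=> a u v; apply: (scalerDr (nu a) (u : V) (v : V)). Qed.
Fact scale_alongDl v : {morph scale_along^~ v : a b / a + b}.
Proof. by move=> a b; rewrite /scale_along rmorphD; apply: scalerDl. Qed.

HB.instance Definition _ := GRing.Zmodule_isLmodule.Build R restrict_scalars
  scale_alongA scale_along1 scale_alongDr scale_alongDl.

Lemma restrict_scalarsZ a (v : restrict_scalars) :
  a *: v = nu a *: (v : V) :> V.
Proof. by []. Qed.
End Restriction.

Section TensorLift.
Variables (R : nzRingType) (M : lmodType R) (N W : zmodType).
Variable b : M -> N -> W.
Hypothesis bDl : forall k, {morph b^~ k : m m' / m + m'}.
Hypothesis bDr : forall m, {morph b m : k k' / k + k'}.

(** The quotient defining the tensor product is one of modules over the integers,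
hence the target is made such a module. *)
Definition tensor_lift (t : tensorZ M N) : W :=
  qlift (fglift (fun p : M * N => b p.1 p.2 : zmodule W)) t.

Fact tensor_lift_kill u : bilin_rel u ->
  fglift (fun p : M * N => b p.1 p.2 : zmodule W) u = 0.
Proof.
by case=> *; rewrite !linearB /= !liftU !scale1r /= ?bDl ?bDr addrAC addrK subrr.
Qed.

Lemma tensor_liftE m k : tensor_lift (tens m k) = b m k.
Proof. by rewrite /tensor_lift /tens (qliftE _ tensor_lift_kill) /= liftU scale1r. Qed.

Lemma tensor_liftD : {morph tensor_lift : s t / s + t}.
Proof.
move=> s t; have := qlift_linear tensor_lift_kill 1 s t.
by rewrite !scale1r.
Qed.
End TensorLift.

Lemma tens0l (R : nzRingType) (M : lmodType R) (N : zmodType) (m : M) :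
  tens m 0 = 0 :> tensorZ M N.
Proof. by apply: (addrI (tens m 0)); rewrite -tensDr !addr0. Qed.

Lemma tens0r (R : nzRingType) (M : lmodType R) (N : zmodType) (k : N) :
  tens 0 k = 0 :> tensorZ M N.
Proof. by apply: (addrI (tens 0 k)); rewrite -tensDl !addr0. Qed.

(** * Homology of isomorphic complexes *)

Section HomologyFunctoriality.
Variables (R R' : nzRingType) (l : nat).
Variables (C : fcomplex R l) (D : fcomplex R' l) (nu : {rmorphism R -> R'}).

(** Homology is the quotient of the kernel of the differential by the boundaries in
it, and an isomorphism commuting with the differentials carries both over.  A
homology class is homogeneous when some homogeneous cycle represents it, so
homogeneity is transported backwards by taking the preimage of such a cycle. *)
Lemma fc_isomorphic_homology : fc_isomorphic C D nu -> homology_isomorphic C D nu.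
Proof.
case=> f [f_bij fd f_homog _].
have [g _ gK] := f_bij.
have f_cycle (c : cycle (fc_diff C)) : f (cycle_val c) \in kerb (fc_diff D).
  by have /eqP dc := cycleP c; apply/eqP; rewrite -fd dc linear0.
pose fc c := hclass (Cycle (f_cycle c)) : restrict_scalars nu (fc_homology D).
have fc_linear : linear fc.
  move=> a u v; rewrite restrict_scalarsZ.
  apply: etrans (linearP (qproj (@boundary _ _ (fc_diff D))) (nu a) _ _).
  by congr (qproj _ _); apply: val_inj; rewrite /= linearP.
pose fcL : GRing.isLinear R _ _ *:%R fc := GRing.isLinear.Build _ _ _ _ _ fc_linear.
pose fcl : {linear cycle (fc_diff C) -> restrict_scalars nu (fc_homology D)} :=
  HB.pack fc fcL.
have fc_kill c : boundary c -> fcl c = 0.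
  case=> b cb; rewrite /= /fc /hclass -[RHS](linear0 (qproj _)).
  apply/qprojP; rewrite subr0; apply: span_gen; exists (f b).
  by rewrite /= cb fd.
pose F : fc_homology C -> fc_homology D := qlift fcl.
have F_linear : linear_for (nu \; *:%R) F.
  exact: (qlift_linear fc_kill).
pose FL : GRing.isLinear R _ _ (nu \; *:%R) F :=
  GRing.isLinear.Build _ _ _ _ _ F_linear.
pose Fl : {linear fc_homology C -> fc_homology D | nu \; *:%R} := HB.pack F FL.
have FE c : F (hclass c) = hclass (Cycle (f_cycle c)).
  exact: (qliftE c fc_kill).
have hclassP K (CC : fcomplex K l) (h : fc_homology CC) : exists c, h = hclass c.
  by exists (qrepr h); rewrite /hclass qreprK.
have g_cycle (c : cycle (fc_diff D)) : g (cycle_val c) \in kerb (fc_diff C).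
  apply/eqP/(bij_inj f_bij); rewrite linear0 fd gK; exact/eqP/cycleP.
have F_inj : injective F.
  have span_boundary w : span (@boundary _ _ (fc_diff D)) w -> boundary w.
    elim=> [|a u v [b ub] _ [b' vb]]; first by exists 0; rewrite linear0.
    by exists (a *: b + b'); rewrite linearP -ub -vb.
  move=> h h'; have [c ->] := hclassP _ _ h; have [c' ->] := hclassP _ _ h'.
  rewrite !FE => /qprojP /span_boundary [b /= eb].
  apply/qprojP/span_gen; exists (g b); apply: (bij_inj f_bij).
  by rewrite fd gK -eb linearB.
exists Fl; split.
  apply: bijective_of_inj_surj F_inj _ => h; have [c ->] := hclassP _ _ h.
  exists (hclass (Cycle (g_cycle c))); rewrite FE; congr (qproj _ _).
  by apply: val_inj => /=.
move=> k h; split=> [[c kc ->]|[c' kc' e]] /=.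
  by exists (Cycle (f_cycle c)); rewrite ?FE //; apply/f_homog.
exists (Cycle (g_cycle c')); first by apply/f_homog; rewrite /= gK.
by apply: F_inj; rewrite FE [LHS]e; congr (qproj _ _); apply: val_inj => /=.
Qed.
End HomologyFunctoriality.

(** * The kernel and the image of p *)

Section SpinGroup.
Variable n : nat.
Local Open Scope group_scope.
Implicit Types (x y h : spin n) (i j k m : nat).

Local Notation z := (sz n).
Local Notation t := (@st n).

Lemma sz_sq : z * z = 1.
Proof. by rewrite [LHS]spin_mulE; apply/spinP/(SStep [::] [::] (SZ2 n)). Qed.

Lemma stE k (kn : (k < n.-1)%N) : t k = spin_of [:: (Some (Ordinal kn), false)].
Proof. by rewrite /st insubT. Qed.

Lemma st_sq k : (k < n.-1)%N -> t k * t k = z.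
Proof.
by move=> kn; rewrite stE [LHS]spin_mulE; apply/spinP/(SStep [::] [::] (ST2 _)).
Qed.

Lemma st_far j k : (j < n.-1)%N -> (k < n.-1)%N ->
  (j.+1 < k)%N || (k.+1 < j)%N -> t j * t k = z * (t k * t j).
Proof.
move=> jn kn jk; rewrite !stE [LHS]spin_mulE [X in z * X]spin_mulE [RHS]spin_mulE.
exact/spinP/(SStep [::] [::] (@SFar _ (Ordinal jn) (Ordinal kn) jk)).
Qed.

Lemma st_braid j : (j.+1 < n.-1)%N -> t j.+1 * t j * t j.+1 = t j * t j.+1 * t j.
Proof.
move=> kn; have jn := ltnW kn; rewrite !stE.
rewrite -[_ * _ * _]/(spin_mul (spin_mul _ _) _) -[RHS]/(spin_mul (spin_mul _ _) _).
rewrite !spin_mulE; apply/esym/spinP.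
exact/(SStep [::] [::] (@SBraid _ (Ordinal jn) (Ordinal kn) erefl)).
Qed.

(** A subgroup, although only products are mentioned: the inverse of a generator is
its product with z. *)
Inductive parabolic m : spin n -> Prop :=
| Parabolic1 : parabolic m 1
| ParabolicZ x : parabolic m x -> parabolic m (x * z)
| ParabolicT x i : (i < m)%N -> parabolic m x -> parabolic m (x * t i).

Lemma spin_ofV g : spin_of [:: (g, true)] = (spin_of [:: (g, false)])^-1 :> spin n.
Proof. by rewrite [RHS]spin_invE. Qed.

Lemma parabolic_full x : parabolic n.-1 x.
Proof.
rewrite -[x]spin_reprK; elim/last_ind: (spin_repr x) => [|u [g b] pu].
  exact: Parabolic1.
have -> : spin_of (rcons u (g, b)) = spin_of u * spin_of [:: (g, b)] :> spin n.
  by rewrite [RHS]spin_mulE cats1.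
case: g => [k|].
  have tk : spin_of [:: (Some k, false)] = t k by rewrite /st valK.
  case: b; last by rewrite tk; apply: ParabolicT.
  rewrite spin_ofV tk.
  have -> : (t k)^-1 = t k * z.
    by apply: (mulgI (t k)); rewrite mulgV mulgA st_sq // sz_sq.
  by rewrite mulgA; apply/ParabolicZ/ParabolicT.
case: b; last exact: ParabolicZ.
rewrite spin_ofV -/z.
have -> : z^-1 = z by apply: (mulgI z); rewrite mulgV sz_sq.
exact: ParabolicZ.
Qed.

(** The coset representatives of the normal form.  The permutation under descent j k
sends j to j + k ([sproj_descent]), so that those with j + k = m + 1 are told apart by
the preimage of m + 1. *)
Fixpoint descent j k : spin n :=
  if k is k'.+1 then descent j.+1 k' * t j else 1.

(** A generator far below a descent moves to its left at the price of a power of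
z.  That power is absorbed by h', which avoids tracking signs. *)
Lemma descent_far i j k m h : (i.+1 < j)%N -> (j + k <= n.-1)%N -> (i < m)%N ->
  parabolic m h ->
  exists2 h', parabolic m h' & h * descent j k * t i = h' * descent j k.
Proof.
elim: k j h => [|k IH] j h ij jk im ph /=.
  by exists (h * t i); [apply: ParabolicT | rewrite !mulg1].
have [||||h' ph' e] := IH j.+1 (h * z); [lia.. | exact: ParabolicZ |].
exists h' => //; rewrite !mulgA -e -!mulgA (@st_far j i); [|lia..].
by rewrite !mulgA; congr (_ * _ * _); rewrite -!mulgA sz_central.
Qed.

(** A generator t_i with j < i < j + k commutes up to sign with the part of the
descent of index at most i - 2, then the braid relation turns t_i t_{i-1} t_i
into t_{i-1} t_i t_{i-1}, whose first factor commutes up to sign with what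
precedes it: the generator leaves on the left as t_{i-1}. *)
Lemma descent_braid i j k m h : (j < i < j + k)%N -> (j + k <= n.-1)%N ->
  (i <= m)%N -> parabolic m h ->
  exists2 h', parabolic m h' & h * descent j k * t i = h' * descent j k.
Proof.
elim: k j h => [|k IH] j h ij jk im ph /=; first by lia.
have [e|ne] := eqVneq i j.+1.
  case: k {IH} ij jk => [|k] ij jk; first by lia.
  have [||||h' ph' e'] := @descent_far j j.+2 k m h; [lia.. | exact: ph |].
  exists h' => //=; rewrite e !mulgA -e'.
  by rewrite -!mulgA; congr (_ * (_ * _)); rewrite !mulgA st_braid; [|lia].
have [||||h' ph' e] := IH j.+1 (h * z); [lia.. | exact: ParabolicZ |].
exists h' => //; rewrite !mulgA -e -!mulgA (@st_far j i); [|lia..].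
by rewrite !mulgA; congr (_ * _ * _); rewrite -!mulgA sz_central.
Qed.

(** Multiplying h (descent j k) on the right by t_i gives again an element of this
form: the descent is lengthened if i = j - 1, shortened if i = j, and unchanged
if t_i can be moved to its left. *)
Lemma parabolic_coset m x : (m < n.-1)%N -> parabolic m.+1 x ->
  exists h j k, [/\ parabolic m h, (j + k = m.+1)%N & x = h * descent j k].
Proof.
move=> mn; elim=> [|y _ [h [j [k [ph jk ->]]]]|y i im _ [h [j [k [ph jk ->]]]]].
- by exists 1, m.+1, 0; split; rewrite ?addn0 ?mulg1 //; apply: Parabolic1.
- exists (h * z), j, k; split=> //; first exact: ParabolicZ.
  by rewrite -!mulgA sz_central.
have [ij|ij|ij] := ltngtP i j; last first.
- rewrite {}ij in im *; case: k jk => [|k] jk; first by lia.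
  exists (h * z), j.+1, k; split; [exact: ParabolicZ | lia |].
  by rewrite /= -!mulgA st_sq ?sz_central //; lia.
- have [||||h' ph' ->] := @descent_braid i j k m h; [lia.. | exact: ph |].
  by exists h', j, k.
have [e|ne] := eqVneq j i.+1.
  exists h, i, k.+1; split=> //; first by lia.
  by rewrite /= mulgA e.
have [||||h' ph' ->] := @descent_far i j k m h; [lia.. | exact: ph |].
by exists h', j, k.
Qed.

Lemma sproj_st_fix k (i : 'I_n) : (k < n.-1)%N -> i != k :> nat ->
  i != k.+1 :> nat -> sproj (t k) i = i.
Proof.
by move=> kn ik ik1; rewrite (sproj_t (Ordinal kn)) tpermD //= -val_eqE eq_sym.
Qed.

Lemma sproj_st_up k (i j : 'I_n) : (k < n.-1)%N -> i = k :> nat ->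
  j = k.+1 :> nat -> sproj (t k) i = j.
Proof.
move=> kn ik jk; rewrite (sproj_t (Ordinal kn)).
have -> : i = slo (Ordinal kn) by apply: val_inj.
by rewrite tpermL; apply: val_inj.
Qed.

Lemma sproj_parabolic m x (i : 'I_n) : (m <= n.-1)%N -> parabolic m x ->
  (m < i)%N -> sproj x i = i.
Proof.
move=> mn + mi; elim=> [|y _ IH|y j jm _ IH].
- by rewrite sprojE perm1.
- by rewrite sprojM sproj_z /sdot mul1g.
- by rewrite sprojM /sdot permM sproj_st_fix //; lia.
Qed.

Lemma sproj_descent j k (i i' : 'I_n) : (j + k <= n.-1)%N ->
  i = j :> nat -> i' = (j + k)%N :> nat -> sproj (descent j k) i = i'.
Proof.
elim: k j i => [|k IH] j i jk ij i'j /=.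
  by rewrite sprojE perm1; apply: val_inj; rewrite /= ij i'j addn0.
have j1 : (j.+1 < n)%N by lia.
rewrite sprojM /sdot permM (@sproj_st_up j i (Ordinal j1)) //; last by lia.
by apply: IH => //; lia.
Qed.

(** If x lies over the identity and x = h (descent j k) with j + k = m + 1, then x
sends j to h(m + 1) = m + 1, as h permutes {0, ..., m} only; hence j = m + 1 and
x = h belongs to the next smaller parabolic subgroup. *)
Lemma sproj_ker x : sproj x = 1 -> x = 1 \/ x = z.
Proof.
move=> px; have : parabolic 0 x.
  suff descend m : (m <= n.-1)%N -> parabolic m x -> parabolic 0 x.
    exact: descend (leqnn _) (parabolic_full x).
  elim: m => // m IH mn pm.
  have [h [j [k [ph jk e]]]] := parabolic_coset mn pm.
  have mn' : (m.+1 < n)%N by lia.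
  have jn : (j < n)%N by lia.
  have : sproj x (Ordinal jn) = Ordinal mn'.
    rewrite e sprojM /sdot permM (@sproj_descent _ _ _ (Ordinal mn')) //=; last lia.
    by rewrite (sproj_parabolic _ ph) //=; lia.
  rewrite px perm1 => -[jm]; move: e; rewrite (_ : k = 0)%N ?mulg1; last by lia.
  by move=> xh; apply: IH; [lia | rewrite xh].
elim=> [|y _ [->|->]|//]; first by left.
  by right; rewrite mul1g.
by left; apply: sz_sq.
Qed.

Lemma sproj_fiber x y : sproj x = sproj y -> x = y \/ x = z * y.
Proof.
move=> e; have: sproj (x * y^-1) = 1.
  rewrite sprojM e -sprojM mulgV; exact: sprojE.
by case/sproj_ker => /(canRL (mulgK _)); rewrite invgK ?mul1g; [left|right].
Qed.

(** The palindromic word of the lift conjugates successively: t_i conjugates the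
transposition of i + 1 and j into that of i and j. *)
Lemma sproj_stau (r : 'I_n * 'I_n) : r.1 != r.2 ->
  sproj (stau r) = tperm r.1 r.2.
Proof.
have up (i j : 'I_n) : (i < j)%N -> sproj (st_up n i j) = tperm i j.
  move: {2}(j - i)%N (leqnn (j - i)) => d.
  elim: d i => [|d IH] i dij ij; first by lia.
  have i1n : (i.+1 < n)%N by have := ltn_ord j; lia.
  have i1 : (i < n.-1)%N by lia.
  have ei : tperm i (Ordinal i1n) = sproj (t i).
    by rewrite (sproj_t (Ordinal i1)); congr tperm; apply: val_inj.
  have [e|ne] := eqVneq (j : nat) i.+1.
    rewrite (_ : j = Ordinal i1n); last exact: val_inj.
    rewrite ei /st_up /= {1}/index_iota subSnn /= /index_iota subnn /=.
    by rewrite big_seq1.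
  have -> : st_up n i j = t i * st_up n i.+1 j * t i.
    rewrite /st_up /index_iota.
    have -> : (j - i = (j - i.+1).+1)%N by lia.
    have -> : (j.-1 - i = (j.-1 - i.+1).+1)%N by lia.
    by rewrite /= rev_cons -rcons_cat big_cons -cats1 big_cat big_seq1 /= mulgA.
  rewrite !sprojM -ei (IH (Ordinal i1n)) //=; [|lia..].
  rewrite /sdot -{1}(tpermV i) -conjgE tpermJ tpermR tpermD // -val_eqE /=; lia.
rewrite /stau => r12; case: ifP => r_lt; first exact: up.
rewrite sprojM sproj_z /sdot mulg1 up; first exact: tpermC.
by rewrite ltn_neqAle leqNgt r_lt eq_sym andbT.
Qed.

Lemma sproj_surj (s : 'S_n) : exists x, sproj x = s.
Proof.
have [ts -> ts_dist] := prod_tpermP s; elim: ts ts_dist => [|r ts IH] /=.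
  by exists 1; rewrite big_nil sprojE.
case/andP => r12 /IH [x e]; exists (x * stau r).
by rewrite sprojM sproj_stau // e big_cons.
Qed.
End SpinGroup.

(** * Polynomials modulo 2 *)

Lemma F2_cases (k : 'F_2) : k = 0 \/ k = 1.
Proof. by case: k => -[|[|]] // ?; [left | right]; apply: val_inj. Qed.

Lemma F2_mulr2n (k : 'F_2) : k *+ 2 = 0.
Proof. by have [->|->] := F2_cases k; apply: val_inj. Qed.

Lemma intr_F2_eq0 (a : int) : a%:~R = 0 :> 'F_2 -> a = (a %/ 2)%Z *+ 2.
Proof.
have e := divz_eq a 2; rewrite {1 2}e mulr_natr.
rewrite rmorphD /= rmorphMn /= F2_mulr2n add0r.
have : (0 <= (a %% 2)%Z < 2) by rewrite modz_ge0 ?ltz_mod.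
by case: (a %% 2)%Z => -[|[|]] //; rewrite addr0.
Qed.

Section Reduction.
Variable n : nat.

Lemma reductionE (p : {mpoly int[n]}) m : (reduction n p)@_m = (p@_m)%:~R.
Proof. exact: mcoeff_map_mpoly. Qed.

Lemma reduction_eq0 (p : {mpoly int[n]}) :
  reduction n p = 0 -> exists q, p = q *+ 2.
Proof.
move=> p0; exists (\sum_(m <- msupp p) (p@_m %/ 2)%Z *: 'X_[m]).
rewrite -sumrMnl {1}[p]mpolyE; apply: eq_bigr => m _.
by rewrite scalerMnl -intr_F2_eq0 // -reductionE p0 mcoeff0.
Qed.

(** A section of the reduction modulo 2.  It is not additive, but it preserves
supports, which is what the grading and the filtration require. *)
Definition lift_mod2 (p : {mpoly 'F_2[n]}) : {mpoly int[n]} :=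
  \sum_(m <- msupp p) (p@_m : nat)%:Z *: 'X_[m].

Lemma lift_mod2E p m : (lift_mod2 p)@_m = (p@_m : nat)%:Z.
Proof.
rewrite /lift_mod2 raddf_sum /=.
rewrite (eq_bigr (fun m' => if m' == m then (p@_m : nat)%:Z else 0)); last first.
  move=> m' _; rewrite mcoeffZ mcoeffX.
  by case: eqP => [->|_]; rewrite ?mulr1 ?mulr0.
rewrite -big_mkcond; have [mp|mNp] := boolP (m \in msupp p).
  by rewrite -big_filter filter_pred1_uniq ?msupp_uniq // big_seq1.
rewrite big_seq_cond big_pred0; first by rewrite memN_msupp_eq0.
by move=> m'; case: eqP => [->|]; rewrite ?andbF // (negbTE mNp).
Qed.

Lemma lift_mod2K : cancel lift_mod2 (reduction n).
Proof.
move=> p; apply/mpolyP => m; rewrite reductionE lift_mod2E.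
by have [->|->] := F2_cases p@_m.
Qed.

Lemma rect_mon_reduction (G : grid n) x r :
  reduction n (rect_mon int G x r) = rect_mon 'F_2 G x r.
Proof.
rewrite /rect_mon rmorph_prod /=; apply: eq_bigr => k _.
by rewrite rmorphXn /= /reduction map_mpolyX.
Qed.
End Reduction.

(** * Free modules and supports *)

Lemma scale_U (K : choiceType) (R : nzRingType) (a : R) (x : K) :
  a *: << x >> = << a *g x >> :> {freeg K / R}.
Proof. by apply/eqP/freeg_eqP => y; rewrite coeffZ !coeffU mul1r. Qed.

Lemma freeg_ind_scale (R : nzRingType) (K : choiceType)
    (P : {freeg K / R} -> Prop) :
  P 0 -> (forall a x v, P v -> P (a *: << x >> + v)) -> forall v, P v.
Proof.
move=> P0 PD; apply: freeg_ind_dom0 => // a x v _ _ Pv.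
by rewrite -scale_U; apply: PD.
Qed.

Lemma coeff_sumU (R : nzRingType) (K : finType) (c : K -> R) y :
  coeff y (\sum_x c x *: << x >>) = c y.
Proof.
rewrite raddf_sum /= (bigD1 y) //= coeffZ coeffU eqxx !mulr1 big1 ?addr0 //.
by move=> x /negbTE xy; rewrite coeffZ coeffU xy !mulr0.
Qed.

Section Support.
Variables (n : nat) (R : nzRingType) (K : choiceType).
Variable Q : K -> 'X_{1..n} -> Prop.

(** Both the homogeneous parts and the filtration levels of a free complex are of
this form, for a condition Q on the terms U^m x. *)
Definition supported (v : {freeg K / {mpoly R[n]}}) : Prop :=
  forall x m, (coeff x v)@_m != 0 -> Q x m.

Lemma supported0 : supported 0.
Proof. by move=> x m; rewrite coeff0 mcoeff0 eqxx. Qed.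

Lemma supportedD u v : supported u -> supported v -> supported (u + v).
Proof.
move=> su sv x m; rewrite coeffD mcoeffD.
have [->|nz _] := eqVneq (coeff x u)@_m 0; last exact: su.
by rewrite add0r; apply: sv.
Qed.

Lemma supported_sum (I : Type) (s : seq I) (P : pred I) F :
  (forall i, P i -> supported (F i)) -> supported (\sum_(i <- s | P i) F i).
Proof.
by move=> sF; elim/big_ind: _ => //; [apply: supported0 | apply: supportedD].
Qed.

Lemma supportedU (p : {mpoly R[n]}) x :
  (forall m, p@_m != 0 -> Q x m) -> supported (p *: << x >>).
Proof.
move=> sp y m; rewrite coeffZ coeffU mul1r.
have [<-|_] := eqVneq x y; first by rewrite mulr1; apply: sp.
by rewrite mulr0 mcoeff0 eqxx.
Qed.
End Support.

(** * The comparison isomorphism *)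

Section Comparison.
Variables (n : nat) (G : grid n) (l : nat) (L : components G l).

Local Notation spin_free := {freeg (spin n) / {mpoly int[n]}}.
Local Notation sym_free := {freeg ('S_n) / {mpoly 'F_2[n]}}.
Local Notation nu := (reduction n).
Local Notation T := (tensorZ (Cspin_mod n) 'F_2).

Definition project_free : spin_free -> restrict_scalars nu sym_free :=
  fglift (fun x => << sproj x >> : restrict_scalars nu sym_free).

Fact project_free_linear : linear project_free.
Proof. exact: fglift_linear. Qed.

HB.instance Definition _ := GRing.isLinear.Build _ _ _ _ project_free
  project_free_linear.

Lemma project_freeU a x : project_free (a *: << x >>) = nu a *: << sproj x >>.
Proof. by rewrite linearZ /= /project_free liftU scale1r. Qed.

Lemma project_free_kill u : zrel u -> project_free u = 0.
Proof.
case=> x; rewrite /project_free linearD /= !liftU !scale1r.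
rewrite sprojM sproj_z /sdot mulg1 -mulr2n freeg_muln.
rewrite -mulr_natr (_ : 2 = 0 :> {mpoly 'F_2[n]}) ?mulr0 ?freegU0 //.
by apply/mpolyP => m; rewrite mcoeffMn F2_mulr2n mcoeff0.
Qed.

Definition project_mod : Cspin_mod n -> restrict_scalars nu sym_free :=
  qlift project_free.

Lemma project_modE v : project_mod (qproj (@zrel n) v) = project_free v.
Proof. exact: qliftE project_free_kill. Qed.

Fact project_mod_linear : linear project_mod.
Proof. exact: qlift_linear project_free_kill. Qed.

HB.instance Definition _ := GRing.isLinear.Build _ _ _ _ project_mod
  project_mod_linear.

Definition compare : T -> sym_free :=
  tensor_lift (fun (m : Cspin_mod n) (k : 'F_2) =>
    k%:MP *: (project_mod m : sym_free)).

Lemma compareE m k : compare (tens m k) = k%:MP *: (project_mod m : sym_free).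
Proof.
apply: tensor_liftE => [{}k a b | {}m a b]; last by rewrite raddfD scalerDl.
by rewrite raddfD /= scalerDr.
Qed.

Lemma compareD : {morph compare : s t / s + t}.
Proof.
apply: tensor_liftD => [k a b | m a b]; last by rewrite raddfD scalerDl.
by rewrite raddfD /= scalerDr.
Qed.

Lemma compare0 : compare 0 = 0.
Proof. by apply: (addrI (compare 0)); rewrite -compareD !addr0. Qed.

Lemma compare_linear : linear_for (nu \; *:%R) compare.
Proof.
move=> a s t; rewrite compareD; congr (_ + _).
elim/tensorZ_ind: s => [|m k s IH]; first by rewrite scaler0 compare0 /= scaler0.
rewrite scalerDr !compareD /= scalerDr; congr (_ + _); last exact: IH.
rewrite -[a *: tens m k]/(tscale a (tens m k)) /tscale tmapE !compareE /=.
by rewrite linearZ /= restrict_scalarsZ !scalerA mulrC.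
Qed.

Definition section_perm (s : 'S_n) : spin n := projT1 (cid (sproj_surj s)).

Lemma section_permK : cancel section_perm (@sproj n).
Proof. by move=> s; rewrite /section_perm; case: cid. Qed.

Definition expand (c : 'S_n -> {mpoly int[n]}) : spin_free :=
  \sum_(s : 'S_n) c s *: << section_perm s >>.

Lemma compare_expand c :
  compare (tens (qproj (@zrel n) (expand c)) 1) =
  \sum_(s : 'S_n) nu (c s) *: << s >>.
Proof.
rewrite compareE project_modE scale1r /expand raddf_sum.
by apply: eq_bigr => s _; rewrite /= project_freeU section_permK.
Qed.

Lemma qproj_sz x : qproj (@zrel n) << (sz n * x)%g >> = - qproj (@zrel n) << x >>.
Proof.
apply/eqP; rewrite -addr_eq0 -linearD -[0](linear0 (qproj (@zrel n))).
by apply/eqP/qprojP; rewrite subr0; apply/span_gen/ZRel.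
Qed.

(** One representative over each permutation suffices: any other element over it
is z times the representative, hence the opposite of it in the quotient.  The
tensor factor may be taken to be 1, as 0 and 1 are the only elements of Z/2. *)
Lemma tensor_expand (t : T) : exists c, t = tens (qproj (@zrel n) (expand c)) 1.
Proof.
pose normal (t : T) := exists c, t = tens (qproj (@zrel n) (expand c)) 1.
have normal0 : normal 0.
  exists (fun=> 0); rewrite /expand big1 ?linear0 ?tens0r // => s _.
  exact: scale0r.
have normalD s t' : normal s -> normal t' -> normal (s + t').
  move=> [c ->] [d ->]; exists (fun s => c s + d s).
  rewrite -tensDl -linearD /expand -big_split /=; congr (tens (qproj _ _) _).
  by apply: eq_bigr => ? _; rewrite scalerDl.
elim/tensorZ_ind: t => [|m k t nt]; first exact: normal0.
apply: (normalD _ _ _ nt).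
have [->|->] := F2_cases k; first by rewrite tens0l.
rewrite -[m]qreprK; elim/freeg_ind_scale: (qrepr m) => [|a x v IH].
  by rewrite linear0 tens0r.
rewrite linearD tensDl; apply: (normalD) => //.
have normal_section b s :
    normal (tens (qproj (@zrel n) (b *: << section_perm s >>)) 1).
  exists (fun s' => if s' == s then b else 0).
  rewrite /expand (bigD1 s) //= eqxx.
  rewrite big1 ?addr0 // => s' /negbTE ->; exact: scale0r.
have [->|->] := sproj_fiber (esym (section_permK (sproj x))).
  exact: normal_section.
rewrite linearZ /= qproj_sz scalerN -scaleNr -linearZ; exact: normal_section.
Qed.

(** An element of the kernel has, in terms of the representatives, coefficients
that vanish modulo 2; it is therefore of the form 2 m (x) 1 = m (x) 2 = 0. *)
Lemma compare_inj : injective compare.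
Proof.
have kernel t : compare t = 0 -> t = 0.
  have [c ->] := tensor_expand t; rewrite compare_expand => c0.
  have even s : exists d, c s = d *+ 2.
    by apply: reduction_eq0; rewrite -(coeff_sumU (fun s => nu (c s)) s) c0 coeff0.
  have [d cd] := choice even.
  have -> : expand c = expand d *+ 2.
    by rewrite /expand -sumrMnl; apply: eq_bigr => s _; rewrite cd scalerMnl.
  by rewrite mulr2n linearD tensDl -tensDr -mulr2n F2_mulr2n tens0l.
move=> s t st; apply/eqP; rewrite -subr_eq0; apply/eqP/kernel.
apply: (addIr (compare t)); rewrite -compareD subrK add0r; exact: st.
Qed.

Definition lift_tensor (w : sym_free) : T :=
  tens (qproj (@zrel n) (expand (fun s => lift_mod2 (coeff s w)))) 1.

Lemma lift_tensorK : cancel lift_tensor compare.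
Proof.
move=> w; rewrite compare_expand; apply/eqP/freeg_eqP => s.
by rewrite (coeff_sumU (fun s => nu (lift_mod2 (coeff s w)))) lift_mod2K.
Qed.

Lemma compareK : cancel compare lift_tensor.
Proof. by move=> t; apply: compare_inj; rewrite lift_tensorK. Qed.

(** The image of a term U^m x, when it is not zero, is the term U^m p(x), and
conversely [lift_tensor] produces only terms U^m x such that U^m p(x) occurs in
its argument. *)
Lemma compare_supported (Q : 'S_n -> 'X_{1..n} -> Prop) t :
  tens_sub (qimage (supported (fun x => Q (sproj x)))) t <->
  supported Q (compare t).
Proof.
split=> [|sQ].
  elim=> [|q k u [v sv ->] _ su]; first by rewrite compare0; apply: supported0.
  rewrite compareD; apply: supportedD => //; rewrite compareE project_modE.
  have [->|->] := F2_cases k; first by rewrite scale0r; apply: supported0.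
  rewrite scale1r -[v in project_free v]freeg_sumE raddf_sum.
  apply: supported_sum => x _; rewrite -scale_U /= project_freeU.
  apply: supportedU => m; rewrite reductionE => nz; apply: sv.
  by apply: contra_neq nz => ->.
rewrite -[t]compareK -[lift_tensor _]addr0; apply: TensSubD; last exact: TensSub0.
eexists; last by [].
apply: supported_sum => s _; apply: supportedU => m.
rewrite lift_mod2E section_permK => nz; apply: sQ.
by apply: contra_neq nz => ->.
Qed.

(** Each empty rectangle has a unique target, so that the double sum collapses to a
sum over rectangles, which can be compared with [dspin_genE]. *)
Lemma dminus_genE (x : 'S_n) : dminus_gen G x =
  \sum_(r | (r.1 != r.2) && empty_rect x r)
    rect_mon 'F_2 G x r *: << sdot x (tperm r.1 r.2) >>.
Proof.
rewrite /dminus_gen (exchange_big_dep (fun r => (r.1 != r.2) && empty_rect x r)) /=;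
  last by move=> y r _; rewrite inE => /and3P[-> _ ->].
apply: eq_bigr => r /andP[r12 er].
rewrite (big_pred1 (sdot x (tperm r.1 r.2))) // => y.
by rewrite inE r12 er andbT.
Qed.

(** The rectangles from x in the spin extension are those from p(x), and the target
x stau(r) of each lies over the target of the corresponding one. *)
Lemma project_dspin v :
  project_free (fglift (dspin_gen G) v) = fglift (dminus_gen G) (project_free v).
Proof.
elim/freeg_ind_scale: v => [|a x v IH].
  by rewrite !linear0.
rewrite [fglift (dspin_gen G) _]linearD [project_free _]linearD /= IH.
rewrite [X in _ = fglift _ X]linearD [RHS]linearD; congr (_ + _).
rewrite /= project_freeU !linearZ /= !liftU !scale1r.
rewrite dspin_genE dminus_genE restrict_scalarsZ; congr (_ *: _).
rewrite raddf_sum; apply: eq_bigr => r /andP[r12 _].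
by rewrite /= project_freeU rect_mon_reduction sprojM sproj_stau.
Qed.

Lemma compare_diff t :
  compare (fc_diff (fc_tensor (Cspin G L) 'F_2) t) =
  fc_diff (Cminus G L) (compare t).
Proof.
elim/tensorZ_ind: t => [|m k t IH]; first by rewrite linear0 compare0 linear0.
rewrite linearD !compareD [RHS]linearD IH; congr (_ + _).
rewrite /= tmapE /= -[m]qreprK dspinE !compareE !project_modE project_dspin.
by rewrite [RHS]linearZ.
Qed.
End Comparison.

Theorem proposition4p1 (n l : nat) (G : grid n) (L : components G l) :
  fc_isomorphic (fc_tensor (Cspin G L) 'F_2) (Cminus G L) (reduction n)
  /\ homology_isomorphic
       (fc_tensor (Cspin G L) 'F_2) (Cminus G L) (reduction n).
Proof.
suff iso : fc_isomorphic (fc_tensor (Cspin G L) 'F_2) (Cminus G L) (reduction n).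
  by split=> //; apply: fc_isomorphic_homology.
pose compare_lin : GRing.isLinear _ _ _ (reduction n \; *:%R) (@compare n) :=
  GRing.isLinear.Build _ _ _ _ _ (@compare_linear n).
pose f : {linear fc_tensor (Cspin G L) 'F_2 -> Cminus G L | reduction n \; *:%R} :=
  HB.pack (@compare n) compare_lin.
exists f; split=> [|v|k v|s v].
- by exists (@lift_tensor n); [apply: compareK | apply: lift_tensorK].
- exact: compare_diff.
- exact: (compare_supported (fun x m => Maslov G x + MaslovU m = k)).
- exact: (compare_supported
    (fun x m => forall c, Alexander L x c + AlexanderU L m c <= s c)).
Qed.
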